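(* Let $\mu,\nu\in\mathcal M_+(\Omega)$ be finite measures and let $\lambda_1,\lambda_2:\Omega\to\mathbb R_+$ be bounded measurable functions. Let $\hat\Omega=\Omega\cup\{\hat\infty\}$ with $\hat\infty$ an auxiliary point, $\hat\mu=\mu+|\nu|\delta_{\hat\infty}$, $\hat\nu=\nu+|\mu|\delta_{\hat\infty}$, and let $\hat c:\hat\Omega^2\to\mathbb R$ be given by $\hat c(x,y)=c(x,y)-\lambda_1(x)-\lambda_2(y)$ if $(x,y)\in\Omega^2$ and $\hat c(x,y)=0$ otherwise. Let $\gamma\in\Gamma_\le(\mu,\nu)$ and set $$\hat\gamma=\gamma+(\mu-\gamma_1)\otimes\delta_{\hat\infty}+\delta_{\hat\infty}\otimes(\nu-\gamma_2)+|\gamma|\,\delta_{(\hat\infty,\hat\infty)}\in\Gamma(\hat\mu,\hat\nu).$$ Then $\hat\gamma$ is a minimizer of the balanced optimal transport problem $$\inf_{\hat\sigma\in\Gamma(\hat\mu,\hat\nu)}\int_{\hat\Omega^2}\hat c\,d\hat\sigma$$ if and only if $\gamma$ is a minimizer of the generalized optimal partial transport problem $$\inf_{\sigma\in\Gamma_\le(\mu,\nu)}\int_{\Omega^2}\big(c(x,y)-\lambda_1(x)-\lambda_2(y)\big)\,d\sigma(x,y)+\int\lambda_1\,d\mu+\int\lambda_2\,d\nu.$$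
   Context: $\Omega\subset\mathbb R^d$ is a non-empty convex open set; $\mathbb R_+=[0,\infty)$; $c:\Omega^2\to\mathbb R_+$ is lower semicontinuous. $\mathcal M_+$ denotes positive Radon measures, $|\mu|$ denotes the total mass of $\mu$, and $\gamma_1,\gamma_2$ are the first and second marginals of $\gamma$. $\Gamma_\le(\mu,\nu)=\{\gamma\in\mathcal M_+(\Omega^2):\gamma_1\le\mu,\ \gamma_2\le\nu\}$, where $\le$ is the setwise order on measures. $\Gamma(\hat\mu,\hat\nu)$ is the set of positive measures on $\hat\Omega^2$ with first marginal $\hat\mu$ and second marginal $\hat\nu$ (these have equal total mass $|\mu|+|\nu|$). Measures on $\Omega$ and $\Omega^2$ are viewed as measures on $\hat\Omega$ and $\hat\Omega^2$ by extension by zero. *)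

(* Defs.v *)
From HB Require Import structures.
From mathcomp Require Import all_boot all_order all_algebra.
From mathcomp Require Import all_classical all_reals all_analysis.

Set Implicit Arguments.
Unset Strict Implicit.
Unset Printing Implicit Defensive.

Import Order.TTheory GRing.Theory Num.Theory.
Import numFieldNormedType.Exports.

Local Open Scope classical_set_scope.
Local Open Scope ring_scope.
Local Open Scope ereal_scope.

(* The type of points of [Omega], with its subspace topology and its Borel
   sigma-algebra; the proof argument is what makes the type pointed, which
   [measurableType] requires. *)
Definition points (R : realType) (d : nat) (Omega : set 'rV[R]_d)
  (Omega0 : Omega !=set0) : Type := set_type Omega.

Definition borel_display : measure_display. Proof. exact: default_measure_display. Qed.

Section points.
Context (R : realType) (d : nat) (Omega : set 'rV[R]_d) (Omega0 : Omega !=set0).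

HB.instance Definition _ := Topological.on (points Omega0).

Definition points_point : points Omega0 :=
  let: exist x Ox := cid Omega0 in exist _ x (mem_set Ox).

HB.instance Definition _ := isPointed.Build (points Omega0) points_point.

HB.instance Definition _ := @isMeasurable.Build borel_display (points Omega0)
  <<s @open (points Omega0) >>
  (@sigma_algebra0 _ setT _) (@sigma_algebraC _ _) (@sigma_algebra_bigcup _ setT _).

End points.

(* [None] is the auxiliary point; a set is measurable iff its trace on [T] is. *)
Definition hat (T : Type) : Type := option T.

Definition hat_display : measure_display -> measure_display. Proof. exact: id. Qed.

Section hat.
Context (d : measure_display) (T : measurableType d).

HB.instance Definition _ := Choice.on (hat T).
HB.instance Definition _ := isPointed.Build (hat T) None.

Definition hat_measurable (A : set (hat T)) : Prop := measurable (@Some T @^-1` A).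

Let hat_measurable0 : hat_measurable set0.
Proof. by rewrite /hat_measurable preimage_set0. Qed.

Let hat_measurableC A : hat_measurable A -> hat_measurable (~` A).
Proof. by rewrite /hat_measurable preimage_setC; exact: measurableC. Qed.

Let hat_bigcup (F : (set (hat T))^nat) :
  (forall i, hat_measurable (F i)) -> hat_measurable (\bigcup_i F i).
Proof.
by move=> mF; rewrite /hat_measurable preimage_bigcup; apply: bigcupT_measurable => i; exact: mF.
Qed.

HB.instance Definition _ := @isMeasurable.Build (hat_display d) (hat T)
  hat_measurable hat_measurable0 hat_measurableC hat_bigcup.

Lemma measurable_Some : measurable_fun [set: T] (Some : T -> hat T).
Proof. by move=> _ A mA; rewrite setTI; exact: mA. Qed.

End hat.

(* On an open subset of a Euclidean space, a Borel measure is Radon iff it is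
   finite on compact sets. *)
Definition radon (R : realType) (T : topologicalType) (m : set T -> \bar R) :=
  forall K : set T, compact K -> m K < +oo.

Section setwise.
Context (d : measure_display) (T : measurableType d) (R : realType).
Definition setwise_le (m1 m2 : set T -> \bar R) :=
  forall A, measurable A -> m1 A <= m2 A.

Definition setwise_eq (m1 m2 : set T -> \bar R) :=
  forall A, measurable A -> m1 A = m2 A.

End setwise.

Definition is_minimizer (R : realType) (T : Type) (F : set T) (J : T -> \bar R)
  (x : T) := F x /\ forall y, F y -> J x <= J y.

(* [mu - m], a measure because [m <= mu] and [mu] is finite.  Measures of the
   library are total functions, nonnegative on all sets, whence the value
   on the non-measurable ones. *)
Section mdiff.
Context (d : measure_display) (T : measurableType d) (R : realType).
Context (m : {measure set T -> \bar R}) (mu : {finite_measure set T -> \bar R}).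

Definition mdiff of setwise_le m mu := fun A : set T =>
  if A \in measurable then mu A - m A else 0.

Hypothesis m_le : setwise_le m mu.

Let mdiffE A : measurable A -> mdiff m_le A = mu A - m A.
Proof. by move=> mA; rewrite /mdiff mem_set. Qed.

Let mfin A : measurable A -> m A \is a fin_num.
Proof.
move=> mA; rewrite ge0_fin_numE//; apply: le_lt_trans (m_le mA) _.
by rewrite ltey_eq fin_num_measure.
Qed.

Let mdiff0 : mdiff m_le set0 = 0.
Proof. by rewrite mdiffE// !measure0 sube0. Qed.

Let mdiff_ge0 A : 0 <= mdiff m_le A.
Proof.
by rewrite /mdiff; case: ifPn => // /set_mem mA; rewrite sube_ge0 ?m_le// mfin.
Qed.

Let mdiff_sigma_additive : semi_sigma_additive (mdiff m_le).
Proof.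
move=> F mF tF mUF; rewrite mdiffE//.
rewrite (_ : (fun n => _) = (fun n => \sum_(0 <= i < n) mu (F i)) \-
                            (fun n => \sum_(0 <= i < n) m (F i))); last first.
  apply/funext => n /=; rewrite -fin_num_sumeN; last by move=> i _; exact: mfin.
  by rewrite -big_split/=; apply: eq_bigr => i _; rewrite mdiffE.
apply: cvgeB.
- by apply: fin_num_adde_defl; rewrite fin_numN mfin.
- exact: measure_semi_sigma_additive.
- exact: measure_semi_sigma_additive.
Qed.

HB.instance Definition _ := isMeasure.Build _ _ _ (mdiff m_le)
  mdiff0 mdiff_ge0 mdiff_sigma_additive.

Let mdiff_fin : fin_num_fun (mdiff m_le).
Proof. by move=> A mA; rewrite mdiffE// fin_numB fin_num_measure// mfin. Qed.

HB.instance Definition _ := Measure_isFinite.Build _ _ _ (mdiff m_le) mdiff_fin.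

End mdiff.

(* [pushforward], carrying the proof that makes it a measure. *)
Definition image_measure (d1 d2 : measure_display) (T1 : measurableType d1)
    (T2 : measurableType d2) (R : realType) (m : set T1 -> \bar R)
    (f : T1 -> T2) (mf : measurable_fun [set: T1] f) : set T2 -> \bar R :=
  pushforward m f.

Section image_measure.
Context (d1 d2 : measure_display) (T1 : measurableType d1)
  (T2 : measurableType d2) (R : realType) (f : T1 -> T2).
Hypothesis mf : measurable_fun [set: T1] f.

Section measure.
Variable m : {measure set T1 -> \bar R}.

Let image0 : image_measure m mf set0 = 0.
Proof. exact: measure0. Qed.

Let image_ge0 A : 0 <= image_measure m mf A.
Proof. exact: measure_ge0. Qed.

Let image_sigma_additive : semi_sigma_additive (image_measure m mf).
Proof. exact: measure_semi_sigma_additive. Qed.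

HB.instance Definition _ := isMeasure.Build _ _ _ (image_measure m mf)
  image0 image_ge0 image_sigma_additive.

End measure.

Variable m : {finite_measure set T1 -> \bar R}.

Let image_fin : fin_num_fun (image_measure m mf).
Proof.
by move=> A mA; apply: fin_num_measure; rewrite -[X in measurable X]setTI; exact: mf.
Qed.

HB.instance Definition _ := Measure_isFinite.Build _ _ _ (image_measure m mf)
  image_fin.

End image_measure.

Section marginals.
Context (d1 d2 : measure_display) (T1 : measurableType d1)
  (T2 : measurableType d2) (R : realType).

Definition marginal1 (m : {measure set (T1 * T2) -> \bar R}) :=
  image_measure m (@measurable_fst _ _ T1 T2).

Definition marginal2 (m : {measure set (T1 * T2) -> \bar R}) :=
  image_measure m (@measurable_snd _ _ T1 T2).

End marginals.

(* Extension by zero. *)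
Definition hat_ext (d : measure_display) (T : measurableType d) (R : realType)
    (m : set T -> \bar R) : set (hat T) -> \bar R :=
  image_measure m (@measurable_Some d T).

Definition hat_pair (T1 T2 : Type) (z : T1 * T2) : hat T1 * hat T2 :=
  (Some z.1, Some z.2).

Lemma measurable_hat_pair (d1 d2 : measure_display) (T1 : measurableType d1)
    (T2 : measurableType d2) :
  measurable_fun [set: T1 * T2] (@hat_pair T1 T2).
Proof.
apply/measurable_fun_pair; apply: measurableT_comp => //; exact: measurable_Some.
Qed.

Definition hat_ext2 (d : measure_display) (T : measurableType d) (R : realType)
    (m : set (T * T) -> \bar R) : set (hat T * hat T) -> \bar R :=
  image_measure m (@measurable_hat_pair d d T T).

(* The total mass as a real number; it is only used for finite measures. *)
Definition mass (d : measure_display) (T : measurableType d) (R : realType)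
    (m : {measure set T -> \bar R}) : {nonneg R} :=
  NngNum (fine_ge0 (measure_ge0 m [set: T])).

Section transport.
Context (R : realType) (d : nat) (Omega : set 'rV[R]_d) (Omega0 : Omega !=set0).
Local Notation X := (points Omega0).
Implicit Types mu nu : {finite_measure set X -> \bar R}.

Definition Gamma_le mu nu (g : {measure set (X * X) -> \bar R}) :=
  [/\ radon g, setwise_le (marginal1 g) mu & setwise_le (marginal2 g) nu].

Lemma Gamma_le1 mu nu g : Gamma_le mu nu g -> setwise_le (marginal1 g) mu.
Proof. by case. Qed.

Lemma Gamma_le2 mu nu g : Gamma_le mu nu g -> setwise_le (marginal2 g) nu.
Proof. by case. Qed.

(* [hat_measure mu nu] is [mu + |nu| delta_None]. *)
Definition hat_measure mu nu : set (hat X) -> \bar R :=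
  measure_add (hat_ext mu) (mscale (mass nu) \d_(None : hat X)).

Definition hat_Gamma (hmu hnu : set (hat X) -> \bar R)
    (s : {measure set (hat X * hat X) -> \bar R}) :=
  setwise_eq (marginal1 s) hmu /\ setwise_eq (marginal2 s) hnu.

Definition hat_plan mu nu g (hg : Gamma_le mu nu g) :
    {measure set (hat X * hat X) -> \bar R} :=
  measure_add
    (measure_add
      (measure_add (hat_ext2 g)
        (hat_ext (mdiff (Gamma_le1 hg)) \x \d_(None : hat X)))
      (\d_(None : hat X) \x hat_ext (mdiff (Gamma_le2 hg))))
    (mscale (mass g) \d_((None, None) : hat X * hat X)).

Definition reduced_cost (c : X * X -> R) (l1 l2 : X -> R) (z : X * X) : R :=
  (c z - l1 z.1 - l2 z.2)%R.

Definition hat_cost (c : X * X -> R) (l1 l2 : X -> R) (z : hat X * hat X) : R :=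
  match z with
  | (Some x, Some y) => reduced_cost c l1 l2 (x, y)
  | _ => 0%R
  end.

Definition partial_value (c : X * X -> R) (l1 l2 : X -> R) mu nu
    (s : {measure set (X * X) -> \bar R}) : \bar R :=
  \int[s]_z (reduced_cost c l1 l2 z)%:E +
    \int[mu]_x (l1 x)%:E + \int[nu]_y (l2 y)%:E.

Definition balanced_value (c : X * X -> R) (l1 l2 : X -> R)
    (s : {measure set (hat X * hat X) -> \bar R}) : \bar R :=
  \int[s]_z (hat_cost c l1 l2 z)%:E.

End transport.

(* Main.v *)
Require Import Defs.
From mathcomp Require Import all_boot all_order all_algebra.
From mathcomp Require Import all_classical all_reals all_analysis.
From mathcomp Require Import measurable_realfun.
From mathcomp Require Import ring.

Set Implicit Arguments.
Unset Strict Implicit.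
Unset Printing Implicit Defensive.

Import Order.TTheory GRing.Theory Num.Theory.
Import numFieldNormedType.Exports.

Local Open Scope classical_set_scope.
Local Open Scope ring_scope.

(** Every measure [s] on [hat X * hat X] has a part living on [X * X], and since
    [hat_cost] vanishes as soon as one coordinate is [None], the balanced value
    of [s] is the integral of the reduced cost against that part alone
    ([balanced_value_base]).  The two feasible sets match under this
    correspondence.  On one side, the part on [X * X] of an element of
    [hat_Gamma] lies in [Gamma_le]: restricting to pairs of finite points only
    decreases the marginals, and on subsets of [X] the prescribed marginals are
    [mu] and [nu] ([base_part_Gamma_le]).  On the other side, [hat_plan]
    completes any element of [Gamma_le] to an element of [hat_Gamma] whose
    part on [X * X] is that element ([hat_plan_Gamma], [hat_plan_base]): the
    mass not transported is sent to, or taken from, [None], and the atom at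
    [(None, None)] absorbs what remains.  So both problems minimize the same
    integral over the same set of measures, the additive constant of
    [partial_value] being finite because the [lambda]s are bounded
    ([partial_value_le]).

    The integral identity requires the cost to be measurable for the product
    of the two Borel sigma-algebras, whereas lower semicontinuity only gives
    sets that are open in the product topology.  The gap is closed by second
    countability: an open set of [X * X] is a countable union of open
    rectangles ([open_measurable_points2]).  The same fact makes compact sets
    measurable, which is how the finiteness of the part on [X * X] implies
    that it is a Radon measure. *)

(** * Second countability and the Borel sigma-algebra of a product *)

(** The basis consists of the open boxes with rational corners. *)
Lemma second_countable_matrix (R : realType) (m n : nat) :
  @second_countable 'M[R]_(m, n).
Proof.
pose box (qr : 'M[rat]_(m, n) * 'M[rat]_(m, n)) : set 'M[R]_(m, n) :=
  [set M | forall i j, ratr (qr.1 i j) < M i j < ratr (qr.2 i j)].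
have box_open qr : open (box qr).
  rewrite openE => M Mbox; exists (fun i j => [set` `]ratr (qr.1 i j), ratr (qr.2 i j)[ ]).
    by move=> i j; apply: near_in_itvoo; rewrite in_itv/= Mbox.
  by move=> N Nbox i j; have := Nbox i j; rewrite /= in_itv.
exists (range box); first exact/(sub_countable (card_image_le _ _))/countableP.
split=> [_ [qr _ <-]//|M U /nbhs_ballP[e /= e0 eU]].
have /choice[q Mq] (ij : 'I_m * 'I_n) : exists q : rat,
    M ij.1 ij.2 - e < ratr q < M ij.1 ij.2.
  have [|q] := @rat_in_itvoo R (M ij.1 ij.2 - e) (M ij.1 ij.2).
    by rewrite ltrBlDr ltrDl.
  by rewrite in_itv; exists q.
have /choice[r Mr] (ij : 'I_m * 'I_n) : exists r : rat,
    M ij.1 ij.2 < ratr r < M ij.1 ij.2 + e.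
  have [|r] := @rat_in_itvoo R (M ij.1 ij.2) (M ij.1 ij.2 + e).
    by rewrite ltrDl.
  by rewrite in_itv; exists r.
exists (box (\matrix_(i, j) q (i, j), \matrix_(i, j) r (i, j))).
  split; first by exists (\matrix_(i, j) q (i, j), \matrix_(i, j) r (i, j)).
  move=> i j; rewrite /= !mxE.
  by have /andP[_ ->] := Mq (i, j); have /andP[-> _] := Mr (i, j).
move=> N Nbox; apply: eU; split=> // i j.
have := Nbox i j; rewrite /= !mxE => /andP[qN Nr].
have /andP[/= eq _] := Mq (i, j); have /andP[/= _ re] := Mr (i, j).
rewrite /ball/= distrC ltr_distl (lt_trans eq qN) /=.
exact: lt_trans Nr re.
Qed.

Lemma second_countable_initial (S : choiceType) (T : topologicalType)
    (f : S -> T) :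
  @second_countable T -> @second_countable (initial_topology f).
Proof.
move=> [B cB [Bo Bx]]; exists (preimage f @` B).
  exact: sub_countable (card_image_le _ _) cB.
split=> [_ [V BV <-]|x U]; first by exists V => //; exact: Bo.
rewrite nbhsE => -[_ [[V oV <-] /= Vfx] VU].
have [W [BW Wfx] WV] := Bx (f x) V (open_nbhs_nbhs (conj oV Vfx)).
exists (f @^-1` W); first by split=> //; exists W.
by move=> y Wfy; apply: VU; exact: WV.
Qed.

(** Around each point of [U], the two neighbourhoods of a product neighbourhood
    inside [U] can be shrunk to elements of the countable bases, so the
    rectangles of basis elements that are contained in [U] cover it. *)
Lemma open_prod_bigcup (T1 T2 : topologicalType) (U : set (T1 * T2)) :
  @second_countable T1 -> @second_countable T2 -> open U ->
  exists C : set (set T1 * set T2),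
    [/\ countable C, forall c, C c -> open c.1 /\ open c.2 &
        U = \bigcup_(c in C) (c.1 `*` c.2)].
Proof.
move=> [B1 cB1 [B1o B1x]] [B2 cB2 [B2o B2x]] oU.
exists [set c | (B1 `*` B2) c /\ c.1 `*` c.2 `<=` U]; split.
- by apply: sub_countable (countableX cB1 cB2); apply: subset_card_le => c [].
- by move=> c [[/B1o ? /B2o ?] _].
- apply/seteqP; split=> [z Uz|z [c [_ cU] cz]]; last exact: cU.
  have [[P Q] /= [Pz Qz] PQU] : nbhs z U by exact: open_nbhs_nbhs.
  have [V1 [BV1 V1z] V1P] := B1x _ _ Pz; have [V2 [BV2 V2z] V2Q] := B2x _ _ Qz.
  exists (V1, V2) => //; split=> // t [/V1P Pt /V2Q Qt]; exact: PQU.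
Qed.

(** Used to show that a space is Hausdorff by mapping it into Hausdorff spaces
    with continuous functions that jointly separate its points. *)
Lemma cluster_continuous_eq (S T : topologicalType) (f : S -> T) (p q : S) :
  hausdorff_space T -> continuous f -> cluster (nbhs p) q -> f p = f q.
Proof.
move=> hT cf pq; apply: hT => A B /cf fA /cf fB.
by have [z [Az Bz]] := pq _ _ fA fB; exists (f z).
Qed.

Section points.
Context (R : realType) (d : nat) (Omega : set 'rV[R]_d) (Omega0 : Omega !=set0).
Local Notation X := (points Omega0).

Lemma open_measurable_points2 (U : set (X * X)) : open U -> measurable U.
Proof.
have cX : @second_countable X.
  exact/second_countable_initial/second_countable_matrix.
move=> /(open_prod_bigcup cX cX)[C [cC oC ->]].
rewrite bigcup_set_type; apply: countable_bigcupT_measurable => [|[c Cc] /=].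
  by rewrite (eq_countable (card_setT C)).
have [c1_open c2_open] := oC _ (set_mem Cc).
by apply: measurableX; exact: sub_sigma_algebra.
Qed.

(** Compact sets are closed because [X * X] is Hausdorff: its points are
    separated by the two coordinate maps into the ambient space. *)
Lemma compact_measurable_points2 (K : set (X * X)) : compact K -> measurable K.
Proof.
have hX : hausdorff_space (X * X)%type.
  move=> p q pq.
  have hM : hausdorff_space 'rV[R]_d by exact: norm_hausdorff.
  have cval : continuous (set_val : X -> 'rV[R]_d) by exact: initial_continuous.
  apply: injective_projections; apply: val_inj; rewrite -!set_valE.
    apply: (@cluster_continuous_eq _ _ (set_val \o fst)) => // z.
    apply: continuous_comp; [exact: cvg_fst|exact: cval].
  apply: (@cluster_continuous_eq _ _ (set_val \o snd)) => // z.
  apply: continuous_comp; [exact: cvg_snd|exact: cval].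
move=> /(compact_closed hX)/closed_openC/open_measurable_points2/measurableC.
by rewrite setCK.
Qed.

Lemma lsc_measurable_points2 (f : X * X -> R) :
  lower_semicontinuous (EFin \o f) -> measurable_fun setT f.
Proof.
move=> lscf; apply/measurable_EFinP.
apply: (measurability _ (ErealGenOInfty.measurableE R)).
move=> /= _ [_ [a ->]] <-; apply: measurableI => //.
apply: open_measurable_points2; rewrite preimage_itvoy.
by move/lower_semicontinuousP : lscf; exact.
Qed.

End points.

(** * The square inside the extended square *)

Section base.
Context (d1 d2 : measure_display) (T1 : measurableType d1)
  (T2 : measurableType d2) (R : realType).

Definition base : set (hat T1 * hat T2) := range Some `*` range Some.

(** A measurable total extension of the inverse of [hat_pair] on [base]; sending
    [None] to [point] is an arbitrary choice. *)
Definition unhat (z : hat T1 * hat T2) : T1 * T2 :=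
  (odflt point z.1, odflt point z.2).

Lemma unhatK z : base z -> hat_pair (unhat z) = z.
Proof. by case: z => [? ?] [[x _ /= <-] [y _ /= <-]]. Qed.

Lemma base_hat_pair z : base (hat_pair z).
Proof. by split; [exists z.1|exists z.2]. Qed.

Lemma measurable_image_Some (d : measure_display) (T : measurableType d)
    (A : set T) : measurable A -> measurable (Some @` A : set (hat T)).
Proof.
move=> mA; rewrite /measurable/= /hat_measurable.
suff -> : Some @^-1` (Some @` A) = A by [].
by apply/seteqP; split=> [x [y Ay [<-]]//|x Ax]; exists x.
Qed.

Lemma measurable_base : measurable base.
Proof. by apply: measurableX; exact: measurable_image_Some. Qed.

Lemma measurable_unhat : measurable_fun [set: hat T1 * hat T2] unhat.
Proof.
have mo (d : measure_display) (T : measurableType d) :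
    measurable_fun [set: hat T] (odflt point : hat T -> T).
  by move=> _ A mA; rewrite setTI.
by apply/measurable_fun_pair; apply: measurableT_comp => //; exact: mo.
Qed.

(** On [base] the function [F] coincides with [F \o hat_pair \o unhat]. *)
Lemma measurable_fun_base (F : hat T1 * hat T2 -> \bar R) :
  measurable_fun setT (F \o @hat_pair T1 T2) -> measurable_fun base F.
Proof.
move=> mF mE B mB.
have -> : base `&` F @^-1` B =
    base `&` unhat @^-1` ((F \o @hat_pair T1 T2) @^-1` B).
  by apply/seteqP; split=> z [Ez FB]; split=> //; move: FB; rewrite /= unhatK.
apply: measurableI => //; rewrite -[X in measurable X]setTI.
by apply: measurable_unhat => //; rewrite -[X in measurable X]setTI; exact: mF.
Qed.

Definition agree_on_base (s : set (hat T1 * hat T2) -> \bar R)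
    (g : set (T1 * T2) -> \bar R) :=
  forall A, measurable A -> A `<=` base -> s A = g (@hat_pair T1 T2 @^-1` A).

(** Since [F] vanishes off [base], its integral is an integral over [base],
    which sees only the measurable subsets of [base]; there [s] is the image of
    [g] under [hat_pair].  Splitting [F] into its positive and negative parts
    makes the identity hold even when the integral is infinite. *)
Lemma integral_base (s : {measure set (hat T1 * hat T2) -> \bar R})
    (g : {measure set (T1 * T2) -> \bar R}) (F : hat T1 * hat T2 -> \bar R) :
  agree_on_base s g ->
  measurable_fun setT (F \o @hat_pair T1 T2) ->
  (forall z, ~ base z -> F z = 0%E) ->
  (\int[s]_z F z = \int[g]_z F (hat_pair z))%E.
Proof.
move=> sg mF F0.
have ge0 (G : hat T1 * hat T2 -> \bar R) : (forall z, 0 <= G z)%E ->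
    measurable_fun setT (G \o @hat_pair T1 T2) ->
    (forall z, ~ base z -> G z = 0%E) ->
    (\int[s]_z G z = \int[g]_z G (hat_pair z))%E.
  move=> G0 mG Gout.
  have -> : G = G \_ base.
    apply/funext => z; rewrite patchE; case: ifPn => // /negP zE.
    by apply: Gout => /mem_set.
  rewrite -integral_mkcond.
  rewrite (eq_measure_integral (image_measure g (@measurable_hat_pair _ _ T1 T2)))//.
  have mhp := @measurable_hat_pair _ _ T1 T2.
  rewrite (ge0_integral_pushforward mhp g measurable_base (measurable_fun_base mG))//.
  have -> : @hat_pair T1 T2 @^-1` base = setT.
    by apply/seteqP; split=> // z _; exact: base_hat_pair.
  by apply: eq_integral => z _; rewrite patchE mem_set//; exact: base_hat_pair.
rewrite [LHS]integralE [RHS]integralE; congr (_ - _)%E.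
- rewrite ge0//; last 2 first.
  + by rewrite -funepos_comp; exact: measurable_funepos.
  + by move=> z /F0 Fz; rewrite funeposE Fz maxxx.
  + by apply: eq_integral => z _; rewrite !funeposE.
- rewrite ge0//; last 2 first.
  + by rewrite -funeneg_comp; exact: measurable_funeneg.
  + by move=> z /F0 Fz; rewrite funenegE Fz oppe0 maxxx.
  + by apply: eq_integral => z _; rewrite !funenegE.
Qed.

(** Written as the image under [unhat] of a restriction, so that it is a measure
    by construction; it sends [A] to the mass of the image of [A] by
    [hat_pair]. *)
Definition base_part (s : {measure set (hat T1 * hat T2) -> \bar R}) :
    {measure set (T1 * T2) -> \bar R} :=
  image_measure (mrestr s measurable_base) measurable_unhat.

Lemma base_part_base (s : {measure set (hat T1 * hat T2) -> \bar R}) :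
  agree_on_base s (base_part s).
Proof.
move=> A mA AE; congr (s _); apply/seteqP; split=> [z Az|z [Az Ez]].
  by split; [rewrite /preimage/= unhatK//|]; exact: AE.
by move: Az; rewrite /preimage /= unhatK.
Qed.

End base.

(** * Correspondence between plans and partial plans *)

Section plans.
Context (R : realType) (d : nat) (Omega : set 'rV[R]_d) (Omega0 : Omega !=set0).
Local Notation X := (points Omega0).
Implicit Types mu nu : {finite_measure set X -> \bar R}.

Lemma hat_measureE mu nu (B : set (hat X)) :
  hat_measure mu nu B = (mu (Some @^-1` B) + nu setT * (None \in B)%:R%:E)%E.
Proof.
rewrite /hat_measure measure_addE; congr (_ + _)%E.
by rewrite -[nu setT]fineK ?fin_num_measure.
Qed.

Lemma hat_measure_Some mu nu (A : set X) : hat_measure mu nu (Some @` A) = mu A.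
Proof.
rewrite hat_measureE memNset ?mule0 ?adde0; last by case.
congr (mu _).
by apply/seteqP; split=> [x [y Ay [<-]]//|x Ax]; exists x.
Qed.

Lemma base_part_Gamma_le mu nu (s : {measure set (hat X * hat X) -> \bar R}) :
  hat_Gamma (hat_measure mu nu) (hat_measure nu mu) s ->
  Gamma_le mu nu (base_part s).
Proof.
move=> [s1 s2].
have le1 : setwise_le (marginal1 (base_part s)) mu.
  move=> A mA; rewrite -(hat_measure_Some mu nu) -s1; last exact: measurable_image_Some.
  apply: le_measure; rewrite ?inE.
  - apply: measurableI; last exact: measurable_base.
    rewrite -[X in measurable X]setTI; apply: measurable_unhat => //.
    by rewrite -[X in measurable X]setTI; exact: measurable_fst.
  - rewrite -[X in measurable X]setTI; apply: measurable_fst => //.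
    exact: measurable_image_Some.
  - by move=> z [Az [[x _ xz] _]]; exists x => //; move: Az; rewrite /= /preimage/= -xz.
have le2 : setwise_le (marginal2 (base_part s)) nu.
  move=> A mA; rewrite -(hat_measure_Some nu mu) -s2; last exact: measurable_image_Some.
  apply: le_measure; rewrite ?inE.
  - apply: measurableI; last exact: measurable_base.
    rewrite -[X in measurable X]setTI; apply: measurable_unhat => //.
    by rewrite -[X in measurable X]setTI; exact: measurable_snd.
  - rewrite -[X in measurable X]setTI; apply: measurable_snd => //.
    exact: measurable_image_Some.
  - by move=> z [Az [_ [x _ xz]]]; exists x => //; move: Az; rewrite /= /preimage/= -xz.
split=> // K cK.
apply: (@le_lt_trans _ _ (base_part s setT)).
  by apply: le_measure; rewrite ?inE//; exact: compact_measurable_points2.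
apply: le_lt_trans (le1 _ measurableT) _.
by rewrite ltey_eq fin_num_measure.
Qed.

(** The finiteness of [g] is what lets the real number [mass g] stand for
    [g setT]. *)
Lemma hat_planE mu nu g (hg : Gamma_le mu nu g) (A : set (hat X * hat X)) :
  g setT \is a fin_num ->
  (hat_plan hg A = g (@hat_pair X X @^-1` A) +
    (hat_ext (mdiff (Gamma_le1 hg)) \x \d_(None : hat X)) A +
    (\d_(None : hat X) \x hat_ext (mdiff (Gamma_le2 hg))) A +
    g setT * ((None, None) \in A)%:R%:E)%E.
Proof.
move=> gT.
etransitivity; first exact: measure_addE.
congr (_ + _)%E; last by rewrite -[g setT]fineK.
etransitivity; first exact: measure_addE.
congr (_ + _)%E.
exact: measure_addE.
Qed.

Lemma Gamma_le_fin mu nu g : Gamma_le mu nu g -> g setT \is a fin_num.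
Proof.
case=> _ g1 _; rewrite ge0_fin_numE//; apply: le_lt_trans (g1 _ measurableT) _.
by rewrite ltey_eq fin_num_measure.
Qed.

Lemma hat_ext_mdiff (m : {measure set X -> \bar R}) mu (le : setwise_le m mu)
    (A : set (hat X)) : measurable A ->
  hat_ext (mdiff le) A = (mu (Some @^-1` A) - m (Some @^-1` A))%E.
Proof.
move=> mA; transitivity (mdiff le (Some @^-1` A)) => //.
by rewrite /mdiff mem_set.
Qed.

Lemma mdiff_dirac_rect (m : {measure set X -> \bar R}) mu
    (le : setwise_le m mu) (A B : set (hat X)) : measurable A -> measurable B ->
  ((hat_ext (mdiff le) \x \d_(None : hat X)) (A `*` B) =
   (mu (Some @^-1` A) - m (Some @^-1` A)) * (None \in B)%:R%:E)%E.
Proof.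
by move=> mA mB; rewrite product_measure1E//; congr (_ * _)%E; exact: hat_ext_mdiff.
Qed.

Lemma dirac_mdiff_rect (m : {measure set X -> \bar R}) mu
    (le : setwise_le m mu) (A B : set (hat X)) : measurable A -> measurable B ->
  ((\d_(None : hat X) \x hat_ext (mdiff le)) (A `*` B) =
   (None \in A)%:R%:E * (mu (Some @^-1` B) - m (Some @^-1` B)))%E.
Proof.
by move=> mA mB; rewrite product_measure1E//; congr (_ * _)%E; exact: hat_ext_mdiff.
Qed.

(** The atom at [None] of the first marginal receives the untransported mass
    [|nu| - |g|] of [nu] and the mass [|g|] put at [(None, None)], in total
    [|nu|]; that of the second marginal receives [|mu|] likewise. *)
Lemma hat_plan_Gamma mu nu g (hg : Gamma_le mu nu g) :
  hat_Gamma (hat_measure mu nu) (hat_measure nu mu) (hat_plan hg).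
Proof.
have [_ g1 g2] := hg.
have gT := Gamma_le_fin hg.
have le_fin m (n : {finite_measure set X -> \bar R}) A : (0 <= m A)%E ->
    setwise_le m n -> measurable A -> m A \is a fin_num.
  move=> m0 mn mA; rewrite ge0_fin_numE//; apply: le_lt_trans (mn _ mA) _.
  by rewrite ltey_eq fin_num_measure.
(* Here [a] is the transported mass of a set, [b] its full mass, [p] and [q]
   are the total masses of the other marginal and of the plan, and [e] tells
   whether the set contains [None]. *)
have mass_balance (a b p q e : \bar R) : a \is a fin_num -> b \is a fin_num ->
    p \is a fin_num -> q \is a fin_num -> e \is a fin_num ->
    (a + (b - a) + e * (p - q) + q * e = b + p * e)%E.
  move: a b p q e => [a||] [b||] [p||] [q||] [e||] // _ _ _ _ _.
  by rewrite -!(EFinM, EFinB, EFinD); congr (_%:E); ring.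
split=> B mB.
- rewrite hat_measureE -(mass_balance (marginal1 g (Some @^-1` B)) _ _ (g setT))//; last 3 first.
  + exact: le_fin g1 _.
  + exact: fin_num_measure.
  + exact: fin_num_measure.
  have -> : marginal1 (hat_plan hg) B = hat_plan hg (B `*` [set: hat X]).
    by congr (hat_plan hg _); apply/seteqP; split=> // z [].
  rewrite hat_planE// mdiff_dirac_rect// dirac_mdiff_rect// mem_set// mule1.
  congr (_ + _ + _ + _)%E.
    by congr (g _); apply/seteqP; split=> // z [].
  by rewrite in_setX/= in_setT andbT.
- rewrite hat_measureE -(mass_balance (marginal2 g (Some @^-1` B)) _ _ (g setT))//; last 3 first.
  + exact: le_fin g2 _.
  + exact: fin_num_measure.
  + exact: fin_num_measure.
  have -> : marginal2 (hat_plan hg) B = hat_plan hg ([set: hat X] `*` B).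
    by congr (hat_plan hg _); apply/seteqP; split=> // z [].
  rewrite hat_planE// mdiff_dirac_rect// dirac_mdiff_rect// (@mem_set _ setT)// mul1e.
  rewrite [X in (X + _ = _)%E]addeAC in_setX/= in_setT/=.
  congr (_ + _ + _ + _)%E; last exact: muleC.
  by congr (g _); apply/seteqP; split=> // z [].
Qed.

(** The three terms of [hat_plan] other than [hat_ext2 g] charge only pairs
    with a coordinate equal to [None]. *)
Lemma hat_plan_base mu nu g (hg : Gamma_le mu nu g) :
  agree_on_base (hat_plan hg) g.
Proof.
move=> A mA AE; rewrite hat_planE ?(Gamma_le_fin hg)//.
(* The two product terms are controlled through the rectangle containing [A],
   on which product measures can be evaluated. *)
have sub0 (m : {measure set (hat X * hat X) -> \bar R}) :
    m (range (@Some X) `*` range (@Some X)) = 0%E -> m A = 0%E.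
  move=> mE; apply/eqP; rewrite eq_le measure_ge0 andbT -mE.
  by apply: le_measure; rewrite ?inE//; exact: measurable_base.
have mS := measurable_image_Some (@measurableT _ X).
have nS : (None \in (range Some : set (hat X))) = false.
  by apply/negP => /set_mem[].
rewrite (sub0 (hat_ext _ \x _))%E; last first.
  by etransitivity; [exact: mdiff_dirac_rect|rewrite nS mule0].
rewrite (sub0 (_ \x hat_ext _))%E; last first.
  by etransitivity; [exact: dirac_mdiff_rect|rewrite nS mul0e].
rewrite memNset ?mule0 ?adde0//.
by move=> /AE[[]].
Qed.

Lemma balanced_value_base (c : X * X -> R) (l1 l2 : X -> R)
    (s : {measure set (hat X * hat X) -> \bar R})
    (g : {measure set (X * X) -> \bar R}) :
  measurable_fun setT c -> measurable_fun setT l1 -> measurable_fun setT l2 ->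
  agree_on_base s g ->
  (balanced_value c l1 l2 s = \int[g]_z (reduced_cost c l1 l2 z)%:E)%E.
Proof.
move=> mc m1 m2 sg.
have mr : measurable_fun setT (reduced_cost c l1 l2).
  by apply: measurable_funB; [apply: measurable_funB => //|]; exact: measurableT_comp.
rewrite /balanced_value (@integral_base _ _ _ _ _ _ _ (fun z => (hat_cost c l1 l2 z)%:E) sg).
- by apply: eq_integral => -[].
- rewrite (_ : _ \o _ = EFin \o reduced_cost c l1 l2); last by apply/funext => -[].
  exact/measurable_EFinP.
- move=> [[x|] [y|]]//= nb; case: nb.
  exact: (base_hat_pair (x, y)).
Qed.

(** The two integrals of the [lambda]s are finite, hence can be cancelled from
    an inequality between extended reals. *)
Lemma partial_value_le (c : X * X -> R) (l1 l2 : X -> R) mu nu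
    (s t : {measure set (X * X) -> \bar R}) :
  measurable_fun setT l1 -> measurable_fun setT l2 ->
  [bounded l1 x | x in [set: X]] -> [bounded l2 y | y in [set: X]] ->
  (partial_value c l1 l2 mu nu s <= partial_value c l1 l2 mu nu t)%E =
  (\int[s]_z (reduced_cost c l1 l2 z)%:E <= \int[t]_z (reduced_cost c l1 l2 z)%:E)%E.
Proof.
move=> m1 m2 b1 b2.
have fin (m : {finite_measure set X -> \bar R}) (l : X -> R) : measurable_fun setT l ->
    [bounded l x | x in [set: X]] -> (\int[m]_x (l x)%:E)%E \is a fin_num.
  move=> ml bl; apply: integrable_fin_num => //.
  apply: measurable_bounded_integrable => //.
  by rewrite ltey_eq fin_num_measure.
by rewrite /partial_value !leeD2rE// fin.
Qed.

End plans.

Unset Implicit Arguments.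

Theorem lemma4 (R : realType) (d : nat) (Omega : set 'rV[R]_d)
    (Omega0 : Omega !=set0)
    (Omega_convex : @convex_set R 'rV[R]_d Omega)
    (Omega_open : open Omega)
    (c : points Omega0 * points Omega0 -> R)
    (c_ge0 : forall z, 0 <= c z)
    (c_lsc : lower_semicontinuous (EFin \o c))
    (mu nu : {finite_measure set (points Omega0) -> \bar R})
    (mu_radon : radon mu) (nu_radon : radon nu)
    (lambda1 lambda2 : points Omega0 -> R)
    (lambda1_ge0 : forall x, 0 <= lambda1 x)
    (lambda2_ge0 : forall y, 0 <= lambda2 y)
    (lambda1_bounded : [bounded lambda1 x | x in [set: points Omega0]])
    (lambda2_bounded : [bounded lambda2 y | y in [set: points Omega0]])
    (lambda1_measurable : measurable_fun setT lambda1)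
    (lambda2_measurable : measurable_fun setT lambda2)
    (gamma : {measure set (points Omega0 * points Omega0) -> \bar R})
    (gamma_Gamma : Gamma_le mu nu gamma) :
  let hat_gamma := hat_plan gamma_Gamma in
  hat_Gamma (hat_measure mu nu) (hat_measure nu mu) hat_gamma /\
  (is_minimizer (hat_Gamma (hat_measure mu nu) (hat_measure nu mu))
      (balanced_value c lambda1 lambda2) hat_gamma
   <->
   is_minimizer (Gamma_le mu nu)
      (partial_value c lambda1 lambda2 mu nu) gamma).
Proof.
have mc := lsc_measurable_points2 c_lsc.
have bal s g := @balanced_value_base _ _ _ Omega0 c lambda1 lambda2 s g
  mc lambda1_measurable lambda2_measurable.
move=> hat_gamma; split; first exact: hat_plan_Gamma.
split=> [[_ hmin]|[_ pmin]]; split=> //.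
- move=> s hs; rewrite partial_value_le//.
  have := hmin _ (hat_plan_Gamma hs).
  by rewrite (bal _ _ (hat_plan_base gamma_Gamma)) (bal _ _ (hat_plan_base hs)).
- exact: hat_plan_Gamma.
- move=> s hs; rewrite (bal _ _ (hat_plan_base gamma_Gamma)) (bal _ _ (base_part_base s)).
  have := pmin _ (base_part_Gamma_le hs).
  by rewrite partial_value_le.
Qed.
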